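(* Let $n \ge 1$ and $m \ge 1$ be integers. For $1 \le i \le m$ and $1 \le j \le n$ let $a_{ij} \le b_{ij}$ be integers, let $$K_i = \prod_{j=1}^n [a_{ij}, b_{ij}]_{\mathbb{Z}} \subset \mathbb{Z}^n,$$ and let $X = \bigcup_{i=1}^m K_i$. Suppose $X$ is $c_n$-connected. Let $A_i = Bd(K_i)$ and let $A = \bigcup_{i=1}^m A_i$. Then $A$ is a freezing set for $(X, c_n)$.
   Context: For integers $a \le b$, $[a,b]_{\mathbb{Z}} = \{z \in \mathbb{Z} : a \le z \le b\}$. For $1 \le u \le n$, distinct points $x,y \in \mathbb{Z}^n$ are $c_u$-adjacent if $|x_i-y_i| = 1$ for at most $u$ indices $i$ and $x_j = y_j$ for all other indices $j$. (So $c_1$-adjacent means differing by $1$ in exactly one coordinate, and $c_n$-adjacent means distinct with all coordinates differing by at most $1$.) For $X \subset \mathbb{Z}^n$, $(X,c_n)$ is the graph with vertex set $X$ and edges given by $c_n$-adjacency; $X$ is $c_n$-connected if this graph is connected. The boundary of $K \subset \mathbb{Z}^n$ is $Bd(K) = \{x \in K : \text{there exists } y \in \mathbb{Z}^n \setminus K \text{ that is } c_1\text{-adjacent to } x\}$. A function $f: X \to X$ is $c_n$-continuous if it sends $c_n$-connected subsets to $c_n$-connected subsets; equivalently, whenever $x,y \in X$ are $c_n$-adjacent, $f(x)$ and $f(y)$ are $c_n$-adjacent or equal. $C(X,c_n)$ is the set of $c_n$-continuous functions $X \to X$, and $\mathrm{Fix}(f) = \{x \in X : f(x) = x\}$. A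 set $A \subset X$ is a freezing set for $(X,c_n)$ if for every $g \in C(X,c_n)$, $A \subset \mathrm{Fix}(g)$ implies $g = \mathrm{id}_X$. *)

(* Defs.v *)
From mathcomp Require Import all_boot all_order all_algebra.
From mathcomp Require Import all_classical.

Set Implicit Arguments.
Unset Strict Implicit.
Unset Printing Implicit Defensive.

Import Order.TTheory GRing.Theory Num.Theory.

Local Open Scope classical_set_scope.
Local Open Scope ring_scope.

(* The lattice Z^n. *)
Notation lattice n := {ffun 'I_n -> int}.

(* The adjacency c_u is meant for 1 <= u <= n. *)
Definition c_adj (n u : nat) (x y : lattice n) : bool :=
  [&& x != y,
      [forall i, (`|x i - y i| == 1) || (x i == y i)]
    & (#|[pred i | (`|x i - y i| == 1)%R]| <= u)%N].

(* The empty set counts as connected. *)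
Definition c_connected (n u : nat) (X : set (lattice n)) : Prop :=
  forall x y : lattice n, X x -> X y ->
    exists p : seq (lattice n),
      [/\ path (c_adj u) x p, last x p = y & forall z, z \in p -> X z].

Definition Bd (n : nat) (K : set (lattice n)) : set (lattice n) :=
  [set x | K x /\ exists y, ~ K y /\ c_adj 1 x y].

(* A self-map of X is a function on the subtype of points of X; subsets of X
   are carried back to Z^n by [val], since connectedness is a notion for
   subsets of Z^n. *)
Definition c_continuous (n u : nat) (X : set (lattice n)) (f : X -> X) : Prop :=
  forall Y : set X,
    c_connected u [set val x | x in Y] ->
    c_connected u [set val (f x) | x in Y].

Definition Fix (n : nat) (X : set (lattice n)) (f : X -> X) : set (lattice n) :=
  [set val x | x in [set x : X | f x = x]].

Definition freezing_set (n u : nat) (X A : set (lattice n)) : Prop :=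
  A `<=` X /\
  forall g : X -> X, c_continuous u g -> A `<=` Fix g -> g = id.

Definition box (n : nat) (a b : 'I_n -> int) : set (lattice n) :=
  [set x | forall j, a j <= x j <= b j].

(* Main.v *)
(** A [c_n]-continuous map moves each coordinate by at most one between
    [c_n]-adjacent points, so along a coordinate segment inside a box it is
    1-Lipschitz in that coordinate. The two ends of the segment through [x] in
    direction [j] lie on the boundary of the box and are fixed; comparing with
    the lower end gives [g x j <= x j], with the upper end [x j <= g x j]. *)

Require Import Defs.
From mathcomp Require Import all_boot all_order all_algebra.
From mathcomp Require Import all_classical.
From mathcomp Require Import zify.

Set Implicit Arguments.
Unset Strict Implicit.
Unset Printing Implicit Defensive.

Import Order.TTheory GRing.Theory Num.Theory.

Local Open Scope classical_set_scope.
Local Open Scope ring_scope.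

Definition upd (n : nat) (x : lattice n) (j : 'I_n) (t : int) : lattice n :=
  [ffun i => if i == j then t else x i].

Lemma c_adj_upd (n u : nat) (x : lattice n) (j : 'I_n) (t : int) :
  (0 < u)%N -> `|x j - t| = 1 -> c_adj u x (upd x j t).
Proof.
move=> u0 xt; apply/and3P; split.
- apply/eqP => /(congr1 (fun f : lattice n => f j)); rewrite ffunE eqxx => e.
  by move: xt; rewrite e subrr normr0.
- apply/forallP => i; rewrite ffunE; case: (eqVneq i j) => [->|_].
    by rewrite xt eqxx.
  by rewrite eqxx orbT.
- apply: leq_trans u0; rewrite -(card1 j); apply/subset_leq_card/fintype.subsetP => i.
  rewrite !inE ffunE; case: (eqVneq i j) => // _.
  by rewrite subrr normr0.
Qed.

Lemma c_adj_sym (n u : nat) : symmetric (@c_adj n u).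
Proof.
move=> x y; rewrite /c_adj eq_sym; congr [&& _, _ & _].
  by apply: eq_forallb => i; rewrite distrC (eq_sym (x i)).
by congr (_ <= _)%N; apply: eq_card => i; rewrite !inE distrC.
Qed.

Lemma c_adj_dist (n u : nat) (x y : lattice n) (j : 'I_n) :
  c_adj u x y -> `|x j - y j| <= 1.
Proof.
case/and3P=> _ /forallP/(_ j)/orP[/eqP->//|/eqP->] _.
by rewrite subrr normr0.
Qed.

(** The pair of adjacent points is connected, hence so is its image, which has at most two points. A
    path inside the image from [g x] to [g y] is either empty or leaves [g x] at once for [g y]. *)
Lemma c_continuous_adj (n u : nat) (X : set (lattice n)) (g : X -> X)
    (x y : X) :
  c_continuous u g -> c_adj u (val x) (val y) ->
  g x = g y \/ c_adj u (val (g x)) (val (g y)).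
Proof.
move=> cg xy.
have /cg conn : c_connected u [set val z | z in [set x; y]].
  move=> _ _ [p [->|->] <-] [q [->|->] <-].
  - by exists [::]; split.
  - exists [:: val y]; split=> //=; first by rewrite xy.
    by move=> z; rewrite inE => /eqP ->; exists y => //; right.
  - exists [:: val x]; split=> //=; first by rewrite c_adj_sym xy.
    by move=> z; rewrite inE => /eqP ->; exists x => //; left.
  - by exists [::]; split.
have [||p [pp pl pX]] := conn (val (g x)) (val (g y)).
- by exists x => //; left.
- by exists y => //; right.
case: p pp pl pX => [_ /= /val_inj|z p /= /andP[xz _] _ pX]; first by left.
(* The first vertex [z] of the path is [g x] or [g y]; the former is excluded because adjacent
   points are distinct. *)
have [|w [->|->] wz] := pX z; first by rewrite inE eqxx.
  by move: xz; rewrite -wz /c_adj eqxx.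
by right; rewrite wz.
Qed.

(** Induction on the length [k]: each unit step along the segment changes coordinate [j] of the
    image by at most one, and the triangle inequality adds these up. *)
Lemma c_continuous_segment (n u : nat) (X : set (lattice n)) (g : X -> X)
    (a b : 'I_n -> int) (j : 'I_n) (k : nat) (x y : X) :
  (0 < u)%N -> c_continuous u g -> box a b `<=` X ->
  box a b (val x) -> box a b (val y) ->
  val y = upd (val x) j (val x j + k%:Z) ->
  `|val (g y) j - val (g x) j| <= k%:Z.
Proof.
move=> u0 cg bX bx; elim: k y => [|k IH] y bY ey.
  suff -> : y = x by rewrite subrr normr0.
  apply: val_inj; rewrite ey; apply/ffunP => i; rewrite ffunE addr0.
  by case: eqVneq => // ->.
(* The last point before [y] on the segment; it lies in the box, hence in [X], since its coordinate
   [j] is between those of [x] and [y]. *)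
pose z := upd (val x) j (val x j + k%:Z).
have bz : box a b z.
  move=> i; rewrite ffunE; case: eqVneq => [->|_]; last exact: bx.
  have := bx j; have := bY j; rewrite ey ffunE eqxx; lia.
pose z' : X := SigSub (mem_set (bX _ bz)).
have yE : val y = upd z j (val x j + k.+1%:Z).
  by rewrite ey; apply/ffunP => i; rewrite !ffunE; case: eqVneq.
have zy : c_adj u (val z') (val y).
  by rewrite yE; apply: c_adj_upd => //; rewrite ffunE eqxx; lia.
have h1 := IH z' bz erefl.
have h2 : `|val (g z') j - val (g y) j| <= 1.
  have [->|/c_adj_dist//] := c_continuous_adj cg zy.
  by rewrite subrr normr0.
lia.
Qed.

(** One step outward across the face in direction [j] leaves the box. *)
Lemma Bd_box (n : nat) (a b : 'I_n -> int) (x : lattice n) (j : 'I_n) :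
  box a b x -> x j = a j \/ x j = b j -> Bd (box a b) x.
Proof.
move=> bx xj; split=> //.
case: xj => xj; [exists (upd x j (a j - 1))|exists (upd x j (b j + 1))];
  (split; last by apply: c_adj_upd => //; rewrite xj; lia);
  by move=> /(_ j); rewrite ffunE eqxx; lia.
Qed.

Theorem theorem6p4 (n m : nat) (hn : (1 <= n)%N) (hm : (1 <= m)%N)
    (a b : 'I_m -> 'I_n -> int) (hab : forall i j, a i j <= b i j)
    (hX : c_connected n (\bigcup_(i : 'I_m) box (a i) (b i))) :
  freezing_set n (\bigcup_(i : 'I_m) box (a i) (b i))
                 (\bigcup_(i : 'I_m) Bd (box (a i) (b i))).
Proof.
split=> [x [i _ [bx _]]|g cg fixg]; first by exists i.
apply/funext => x; apply/val_inj/ffunP => j.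
have [i _ bx] := set_valP x.
have bX : box (a i) (b i) `<=` \bigcup_(i : 'I_m) box (a i) (b i).
  by move=> z bz; exists i.
(* Both ends of the segment through [x] in direction [j] lie on faces of the box, so [g] fixes
   them. *)
have end_fixed t : t = a i j \/ t = b i j ->
    exists y, [/\ val y = upd (val x) j t, box (a i) (b i) (val y) & g y = y].
  move=> tab; have bt : box (a i) (b i) (upd (val x) j t).
    move=> l; rewrite ffunE; case: eqVneq => [->|_]; last exact: bx.
    by have := hab i j; lia.
  have /fixg[y gy yE] : (\bigcup_(i : 'I_m) Bd (box (a i) (b i)))
      (upd (val x) j t).
    by exists i => //; apply: (@Bd_box _ _ _ _ j) => //; rewrite ffunE eqxx.
  by exists y; split=> //; rewrite yE.
have [y [yE by_ gy]] := end_fixed _ (or_introl erefl).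
have [z [zE bz gz]] := end_fixed _ (or_intror erefl).
have yj : val y j = a i j by rewrite yE ffunE eqxx.
have zj : val z j = b i j by rewrite zE ffunE eqxx.
(* The segment runs upward from [y] to [x]; as [a i j <= val x j], the absolute value is its true
   length. *)
have lo : `|val (g x) j - val (g y) j| <= `|val x j - a i j|%N%:Z.
  apply: (c_continuous_segment hn cg bX by_ bx).
  apply/ffunP => l; rewrite yj ffunE yE ffunE.
  by case: eqVneq => [->|//]; move: (bx j); set t := fun_of_fin (\val x) j; lia.
have hi : `|val (g z) j - val (g x) j| <= `|b i j - val x j|%N%:Z.
  apply: (c_continuous_segment hn cg bX bx bz).
  by rewrite zE; congr upd; have := bx j; lia.
(* Now [lo] bounds coordinate [j] of [g x] above by that of [x], and [hi] bounds it below. *)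
move: lo hi; rewrite gy gz yj zj; have := bx j; rewrite /=; lia.
Qed.
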